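(* Let $m_1,m_2,\ldots$ be integers with $m_i\ge 2$ for all $i$, and let $$A=\Big\{\epsilon_0+\epsilon_2m_1m_2+\cdots+\epsilon_{2k-2}m_1\cdots m_{2k-2}+\cdots:\ \epsilon_{2i}\in\{0,1,\ldots,m_{2i+1}-1\}\Big\},$$ $$B=\Big\{\epsilon_1m_1+\epsilon_3m_1m_2m_3+\cdots+\epsilon_{2k-1}m_1\cdots m_{2k-1}+\cdots:\ \epsilon_{2i-1}\in\{0,1,\ldots,m_{2i}-1\}\Big\},$$ where in each element only finitely many digits $\epsilon_j$ are nonzero. Then $$SX(A,B)=\limsup_{s\to\infty}\max\left\{\frac{m_1m_3\cdots m_{2s-1}}{\sqrt{(m_1-1)+(m_3-1)m_1m_2+\cdots+(m_{2s-1}-1)m_1m_2\cdots m_{2s-2}}},\ \frac{m_2m_4\cdots m_{2s}}{\sqrt{(m_2-1)m_1+(m_4-1)m_1m_2m_3+\cdots+(m_{2s}-1)m_1m_2\cdots m_{2s-1}}}\right\}.$$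
   Context: For a set $A$ of nonnegative integers, $A(x)$ denotes the number of elements $a\in A$ with $a\le x$. For sets $A,B$ of nonnegative integers, $SX(A,B)=\limsup_{x\to\infty}\frac{\max\{A(x),B(x)\}}{\sqrt x}$. (The sets $A,B$ above are perfect additive complements: every nonnegative integer has exactly one representation $a+b$ with $a\in A$, $b\in B$.) *)

(* Defs.v *)
From mathcomp Require Import all_boot all_order all_algebra finmap.
From mathcomp Require Import all_classical all_reals all_analysis.

Set Implicit Arguments.
Unset Strict Implicit.
Unset Printing Implicit Defensive.
Import Order.TTheory GRing.Theory Num.Theory.
Import numFieldNormedType.Exports.

Local Open Scope classical_set_scope.

(* The counting function [A(x)], for a real argument [x]. The set is finite,
   so [fset_set] does not fall back to its default value. *)
Definition counting_fun (R : realType) (A : set nat) (x : R) : nat :=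
  #|` fset_set [set a | A a /\ (a%:R <= x)%R] |%fset.

(* The limsup is taken in the extended reals: it may be [+oo]. *)
Definition SX (R : realType) (A B : set nat) : \bar R :=
  limf_esup
    (fun x : R =>
       ((maxn (counting_fun A x) (counting_fun B x))%:R / Num.sqrt x)%:E)
    (pinfty_nbhs R).

(* [m_1 m_2 ... m_k]; the value [m 0] is never used. *)
Definition mprod (m : nat -> nat) (k : nat) : nat :=
  \prod_(1 <= j < k.+1) m j.

(* Finite support of the digits is witnessed by the bound [N]. *)
Definition setA (m : nat -> nat) : set nat :=
  [set a | exists (eps : nat -> nat) (N : nat),
     [/\ forall i, eps (2 * i) < m (2 * i + 1),
         forall i, N <= i -> eps (2 * i) = 0
       & a = \sum_(i < N) eps (2 * i) * mprod m (2 * i)] ].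

(* The index [i >= 1] of [epsilon_(2i-1)] is shifted to start at [0]. *)
Definition setB (m : nat -> nat) : set nat :=
  [set b | exists (eps : nat -> nat) (N : nat),
     [/\ forall i, eps (2 * i + 1) < m (2 * i + 2),
         forall i, N <= i -> eps (2 * i + 1) = 0
       & b = \sum_(i < N) eps (2 * i + 1) * mprod m (2 * i + 1)] ].

(* Main.v *)
Require Import Defs.
From mathcomp Require Import all_boot all_order all_algebra.
From mathcomp Require Import all_classical all_reals all_analysis.
From mathcomp Require Import unstable zify ring lra.

Set Implicit Arguments.
Unset Strict Implicit.
Unset Printing Implicit Defensive.
Import Order.TTheory GRing.Theory Num.Theory.
Import numFieldNormedType.Exports.

(** The radices of [A] are [r_i = m_(2i+1)], and its weights
    [w_i = m_1 ... m_(2i)] satisfy [r_i w_i <= w_(i+1)]; the same holds for [B].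
    Under this condition sums [\sum_i d_i w_i] with digits [d_i < r_i] are
    ordered lexicographically from the top digit, so the [n]-th element [g n]
    of [A] (from [n = 0]) carries the digits of [n] in the mixed radix [r].
    With [P_s = r_0 ... r_(s-1)], the point [(n, g n)], for [n < P_(s+1)], lies
    on or above the line through [(P_s - 1, g (P_s - 1))] and
    [(P_(s+1) - 1, g (P_(s+1) - 1))].  As [N] over the square root of a positive
    affine function of [N] is maximal at an endpoint, [A(x) / sqrt x] with
    [P_s <= A(x) < P_(s+1)] is at most its value at [x = g (P_s - 1)] or at
    [x = g (P_(s+1) - 1)]; these values are the terms of the limsup on the
    right. *)

Local Open Scope nat_scope.

Lemma mono_leq_bracket (g : nat -> nat) (t : nat) :
  {mono g : i j / i <= j} -> g 0 <= t -> exists n, g n <= t < g n.+1.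
Proof.
move=> g_mono g0t; have bound n : g n <= t -> n <= t.
  exact/leq_trans/mono_leq_infl.
case: (ex_maxnP (ex_intro (fun n => g n <= t) 0 g0t) bound) => n gnt n_max.
by exists n; rewrite gnt ltnNge; apply/negP => /n_max; rewrite ltnn.
Qed.

Definition radix_prod (r : nat -> nat) (k : nat) : nat := \prod_(i < k) r i.

Definition digit (r : nat -> nat) (n i : nat) : nat :=
  (n %/ radix_prod r i) %% r i.

Definition digit_sum (w d : nat -> nat) (k : nat) : nat :=
  \sum_(i < k) d i * w i.

Definition max_digit_sum (r w : nat -> nat) (k : nat) : nat :=
  digit_sum w (fun i => r i - 1) k.

Definition digit_set (r w : nat -> nat) : set nat :=
  [set a | exists (d : nat -> nat) (N : nat),
     [/\ forall i, d i < r i, forall i, N <= i -> d i = 0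
       & a = digit_sum w d N] ]%classic.

Definition superincreasing (r w : nat -> nat) : Prop :=
  0 < w 0 /\ forall i, r i * w i <= w i.+1.

(* The sum has enough terms because [n < radix_prod r n] for radices above 1. *)
Definition digit_enum (r w : nat -> nat) (n : nat) : nat :=
  digit_sum w (digit r n) n.

Lemma radix_prod0 (r : nat -> nat) : radix_prod r 0 = 1.
Proof. exact: big_ord0. Qed.

Lemma radix_prodS (r : nat -> nat) (k : nat) :
  radix_prod r k.+1 = radix_prod r k * r k.
Proof. exact: big_ord_recr. Qed.

Lemma digit_sum0 (w d : nat -> nat) : digit_sum w d 0 = 0.
Proof. exact: big_ord0. Qed.

Lemma digit_sumS (w d : nat -> nat) (k : nat) :
  digit_sum w d k.+1 = digit_sum w d k + d k * w k.
Proof. exact: big_ord_recr. Qed.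

Lemma digit_sum_stable (w d : nat -> nat) (j k : nat) :
  (forall i, j <= i -> d i = 0) -> (forall i, k <= i -> d i = 0) ->
  digit_sum w d j = digit_sum w d k.
Proof.
wlog le_jk : j k / j <= k => [wlog_le dj dk|dj _].
  by case: (leqP j k) => [/wlog_le|/ltnW/wlog_le->] //; apply.
rewrite -(subnKC le_jk); elim: (k - j) => [|i ->]; first by rewrite addn0.
by rewrite addnS digit_sumS dj ?leq_addr // addn0.
Qed.

Lemma superincreasing_weight_ratio (r w : nat -> nat) (i s : nat) :
  superincreasing r w -> i <= s ->
  radix_prod r s * w i <= radix_prod r i * w s.
Proof.
move=> [_ wS] /subnKC <-; elim: (s - i) => [|k IH]; first by rewrite addn0.
rewrite addnS radix_prodS mulnAC mulnC.
apply: leq_trans (leq_mul (leqnn (radix_prod r i)) (wS _)).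
by rewrite [leqRHS]mulnCA leq_mul2l IH orbT.
Qed.

Lemma digit_sum_lt (r w d : nat -> nat) (k : nat) :
  superincreasing r w -> (forall i, d i < r i) -> digit_sum w d k < w k.
Proof.
move=> [w0 wS] d_lt; elim: k => [|k IH]; first by rewrite digit_sum0.
rewrite digit_sumS; apply: leq_trans (wS k).
by apply: leq_trans (leq_mul (d_lt k) (leqnn _)); rewrite mulSn ltn_add2r.
Qed.

(* Both sides are the lexicographic order on digits, highest index first. *)
Lemma leq_digit_sum (r v w d e : nat -> nat) (k : nat) :
  superincreasing r v -> superincreasing r w ->
  (forall i, d i < r i) -> (forall i, e i < r i) ->
  (digit_sum v d k <= digit_sum v e k) = (digit_sum w d k <= digit_sum w e k).
Proof.
move=> sup_v sup_w d_lt e_lt.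
have sum_lt u a b j : superincreasing r u -> (forall i, a i < r i) ->
    a j < b j -> digit_sum u a j.+1 < digit_sum u b j.+1.
  move=> sup_u a_lt ab; rewrite !digit_sumS.
  apply: leq_trans (leq_addl (digit_sum u b j) _).
  apply: leq_trans (leq_mul ab (leqnn _)).
  by rewrite mulSn ltn_add2r (digit_sum_lt _ sup_u).
elim: k => [|k IH]; first by rewrite !digit_sum0.
case: (ltngtP (d k) (e k)) => [lt_de|lt_ed|eq_de].
- by rewrite !(ltnW (sum_lt _ d e k _ d_lt lt_de)).
- by rewrite [LHS]leqNgt [RHS]leqNgt !(sum_lt _ e d k _ e_lt lt_ed).
- by rewrite !digit_sumS eq_de !leq_add2r.
Qed.

Section MixedRadix.
Variable r : nat -> nat.
Hypothesis r_gt1 : forall i, 1 < r i.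

Lemma ltn_radix_prod (k : nat) : k < radix_prod r k.
Proof.
elim: k => [|k IH]; first by rewrite radix_prod0.
by rewrite radix_prodS; have := r_gt1 k; nia.
Qed.

Lemma radix_prod_gt0 (k : nat) : 0 < radix_prod r k.
Proof. exact: leq_ltn_trans (ltn_radix_prod k). Qed.

Lemma radix_prod_mono : {mono radix_prod r : j k / j <= k}.
Proof.
apply: leq_mono; apply: homo_ltn => [k i j|k]; first exact: ltn_trans.
by rewrite radix_prodS ltn_Pmulr ?radix_prod_gt0.
Qed.

Lemma superincreasing_radix_prod : superincreasing r (radix_prod r).
Proof. by split=> [|i]; rewrite ?radix_prod_gt0 // radix_prodS mulnC. Qed.

Lemma digit_lt (n i : nat) : digit r n i < r i.
Proof. by rewrite ltn_mod ltnW. Qed.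

Lemma digit_small (n i : nat) : n < radix_prod r i -> digit r n i = 0.
Proof. by move=> n_lt; rewrite /digit divn_small ?mod0n. Qed.

Lemma max_digit_lt (i : nat) : r i - 1 < r i.
Proof. by rewrite subn1 ltn_predL ltnW. Qed.

Lemma digit_expansion (n k : nat) :
  n < radix_prod r k -> digit_sum (radix_prod r) (digit r n) k = n.
Proof.
have partial j : digit_sum (radix_prod r) (digit r n) j
    + n %/ radix_prod r j * radix_prod r j = n.
  elim: j => [|j IH]; first by rewrite digit_sum0 radix_prod0 divn1 muln1.
  rewrite digit_sumS radix_prodS divnMA -[RHS]IH /digit.
  by rewrite {3}(divn_eq (n %/ radix_prod r j) (r j)); ring.
by move=> n_lt; rewrite -[RHS](partial k) (divn_small n_lt) addn0.
Qed.

Lemma max_digit_sum_radix_prod (k : nat) :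
  max_digit_sum r (radix_prod r) k = (radix_prod r k).-1.
Proof.
rewrite /max_digit_sum; elim: k => [|k IH].
  by rewrite digit_sum0 radix_prod0.
rewrite digit_sumS IH radix_prodS.
by have := r_gt1 k; have := radix_prod_gt0 k; nia.
Qed.

Variable w : nat -> nat.
Hypothesis w_sup : superincreasing r w.

Lemma digit_enum_expansion (n k : nat) :
  n < radix_prod r k -> digit_enum r w n = digit_sum w (digit r n) k.
Proof.
have vanish j i : n < radix_prod r j -> j <= i -> digit r n i = 0.
  by move=> n_lt ji; rewrite digit_small // (leq_trans n_lt) ?radix_prod_mono.
move=> n_lt; apply: digit_sum_stable => i; apply: vanish => //.
exact: ltn_radix_prod.
Qed.

Lemma digit_enum_digit_sum (d : nat -> nat) (k : nat) :
  (forall i, d i < r i) ->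
  digit_enum r w (digit_sum (radix_prod r) d k) = digit_sum w d k.
Proof.
move=> d_lt; have n_lt := digit_sum_lt k superincreasing_radix_prod d_lt.
rewrite (digit_enum_expansion n_lt); apply/eqP; rewrite eqn_leq.
rewrite -!(leq_digit_sum _ superincreasing_radix_prod w_sup) -?eqn_leq //;
  try exact: digit_lt.
exact/eqP/digit_expansion.
Qed.

Lemma digit_enum_mono : {mono digit_enum r w : n p / n <= p}.
Proof.
move=> n p; pose k := maxn n p.
have n_lt := leq_ltn_trans (leq_maxl n p) (ltn_radix_prod k).
have p_lt := leq_ltn_trans (leq_maxr n p) (ltn_radix_prod k).
rewrite (digit_enum_expansion n_lt) (digit_enum_expansion p_lt).
rewrite -(leq_digit_sum _ superincreasing_radix_prod w_sup) ?digit_expansion //;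
  exact: digit_lt.
Qed.

Lemma digit_enum0 : digit_enum r w 0 = 0.
Proof. exact: digit_sum0. Qed.

Lemma range_digit_enum : range (digit_enum r w) = digit_set r w.
Proof.
apply/seteqP; split=> [_ [n _ <-]|_ [d [k [d_lt _ ->]]]].
  exists (digit r n), n; split=> // i; first exact: digit_lt.
  by move=> le_ni; rewrite digit_small // (leq_ltn_trans le_ni) ?ltn_radix_prod.
by exists (digit_sum (radix_prod r) d k); rewrite ?digit_enum_digit_sum.
Qed.

Lemma digit_enum_max (s : nat) :
  digit_enum r w (radix_prod r s).-1 = max_digit_sum r w s.
Proof.
rewrite -max_digit_sum_radix_prod; apply: digit_enum_digit_sum.
exact: max_digit_lt.
Qed.

Lemma leq_max_digit_sum (s : nat) : s <= max_digit_sum r w s.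
Proof.
rewrite -digit_enum_max; apply: leq_trans (mono_leq_infl digit_enum_mono _).
by rewrite -ltnS prednK ?radix_prod_gt0 ?ltn_radix_prod.
Qed.

(* Termwise, this is the rearrangement inequality for [d_i <= r_i - 1] and
   [P_s w_i <= P_i w_s], where [P = radix_prod r]. *)
Lemma digit_enum_above_chord (s n : nat) : n < radix_prod r s.+1 ->
  w s * n + radix_prod r s * max_digit_sum r w s <=
  radix_prod r s * digit_enum r w n + w s * (radix_prod r s).-1.
Proof.
move=> n_lt; rewrite (digit_enum_expansion n_lt) -max_digit_sum_radix_prod.
rewrite -{1}(digit_expansion n_lt) /max_digit_sum !digit_sumS !mulnDr.
suff : w s * digit_sum (radix_prod r) (digit r n) s +
    radix_prod r s * digit_sum w (fun i => r i - 1) s <=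
    radix_prod r s * digit_sum w (digit r n) s +
    w s * digit_sum (radix_prod r) (fun i => r i - 1) s by nia.
rewrite /digit_sum !big_distrr -!big_split /=; apply: leq_sum => i _.
have := superincreasing_weight_ratio w_sup (ltnW (ltn_ord i)).
by have := digit_lt n i; nia.
Qed.

End MixedRadix.

Local Open Scope ring_scope.

Definition counting_ratio (R : realType) (A : set nat) (x : R) : R :=
  (counting_fun A x)%:R / Num.sqrt x.

Definition max_digit_ratio (R : realType) (r w : nat -> nat) (s : nat) : R :=
  (radix_prod r s)%:R / Num.sqrt (max_digit_sum r w s)%:R.

Lemma counting_fun_range (R : realType) (g : nat -> nat) (x : R) (n : nat) :
  {mono g : i j / (i <= j)%N} -> (g n)%:R <= x < (g n.+1)%:R ->
  counting_fun (range g) x = n.+1.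
Proof.
move=> g_mono /andP[gn_x x_gn]; apply: card_fset_set.
suff -> : [set a | range g a /\ a%:R <= x]%classic = (g @` `I_n.+1)%classic.
  by apply: inj_card_eq => i j _ _; apply: (mono_inj leqnn anti_leq g_mono).
apply/seteqP; split=> [_ [[i _ <-] gi_x]|_ [i /= i_n <-]].
  exists i => //=; rewrite -(leqW_mono g_mono) -(ltr_nat R).
  exact: le_lt_trans x_gn.
by split; [exists i | apply: le_trans gn_x; rewrite ler_nat g_mono].
Qed.

(* The square of the left-hand side, as a function of [N], is a square over an
   affine function, hence convex. *)
Lemma div_sqrt_affine_le (R : rcfType) (p q N a c : R) :
  0 <= p -> p <= N <= q -> 0 < a -> 0 <= c ->
  N / Num.sqrt (a + c * (N - p)) <=
  Num.max (p / Num.sqrt a) (q / Num.sqrt (a + c * (q - p))).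
Proof.
move=> p_ge0 /andP[pN Nq] a_gt0 c_ge0; set K := Num.max _ _.
have K_ge0 : 0 <= K by rewrite le_max divr_ge0 ?sqrtr_ge0.
have affine_gt0 u : p <= u -> 0 < a + c * (u - p).
  by move=> pu; rewrite ltr_pwDl // mulr_ge0 // subr_ge0.
have ratio_le u b : 0 <= u -> 0 < b ->
    (u / Num.sqrt b <= K) = (u ^+ 2 <= K ^+ 2 * b).
  move=> u_ge0 b_gt0; rewrite ler_pdivrMr ?sqrtr_gt0 //.
  rewrite -[LHS](@ler_pXn2r _ 2) ?nnegrE ?mulr_ge0 ?sqrtr_ge0 //.
  by rewrite exprMn sqr_sqrtr // ltW.
have N_ge0 := le_trans p_ge0 pN; have pq := le_trans pN Nq.
have p_le : p ^+ 2 <= K ^+ 2 * a by rewrite -ratio_le // le_max lexx.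
have q_le : q ^+ 2 <= K ^+ 2 * (a + c * (q - p)).
  by rewrite -ratio_le ?affine_gt0 ?le_max ?lexx ?orbT // (le_trans p_ge0).
rewrite ratio_le ?affine_gt0 //.
have [->|N_neq_p] := eqVneq N p; first by rewrite subrr mulr0 addr0.
have pq_gt0 : 0 < q - p.
  by rewrite subr_gt0 (lt_le_trans _ Nq) // lt_neqAle eq_sym N_neq_p.
rewrite -(ler_pM2l pq_gt0).
apply: (@le_trans _ _ ((q - N) * p ^+ 2 + (N - p) * q ^+ 2)).
  rewrite -subr_ge0 [leRHS](_ : _ = (q - p) * ((N - p) * (q - N))).
    by rewrite !mulr_ge0 ?subr_ge0.
  by ring.
rewrite [leRHS](_ : _ = (q - N) * (K ^+ 2 * a)
    + (N - p) * (K ^+ 2 * (a + c * (q - p)))); last by ring.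
by rewrite lerD ?ler_wpM2l ?subr_ge0.
Qed.

Section CountingRatio.
Variables (R : realType) (r w : nat -> nat).
Hypotheses (r_gt1 : forall i, (1 < r i)%N) (w_sup : superincreasing r w).

Local Notation P := (radix_prod r).
Local Notation top := (max_digit_sum r w).

Lemma digit_enum_ratio_le (s n : nat) : (0 < s)%N -> (P s <= n.+1 < P s.+1)%N ->
  n.+1%:R / Num.sqrt (digit_enum r w n)%:R <=
  Num.max (max_digit_ratio R r w s) (max_digit_ratio R r w s.+1).
Proof.
move=> s_gt0 /andP[Ps_n n_PS]; pose slope : R := (w s)%:R / (P s)%:R.
have P_neq0 : (P s)%:R != 0 :> R by rewrite pnatr_eq0 -lt0n radix_prod_gt0.
have top_gt0 : 0 < (top s)%:R :> R.
  by rewrite ltr0n (leq_trans s_gt0) // leq_max_digit_sum.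
have topS : (top s.+1)%:R = (top s)%:R + slope * ((P s.+1)%:R - (P s)%:R).
  rewrite /max_digit_sum digit_sumS radix_prodS natrD !natrM.
  by rewrite natrB ?(ltnW (r_gt1 s)) // /slope; field.
have slope_ge0 : 0 <= slope by rewrite divr_ge0.
have chord : (top s)%:R + slope * (n.+1%:R - (P s)%:R) <= (digit_enum r w n)%:R.
  have P_gt0 : 0 < (P s)%:R :> R by rewrite ltr0n radix_prod_gt0.
  rewrite -(ler_pM2l P_gt0) [leLHS](_ : _ = (P s)%:R * (top s)%:R
    + (w s)%:R * (n.+1%:R - (P s)%:R)); last by rewrite /slope; field.
  have := digit_enum_above_chord r_gt1 w_sup (ltnW n_PS).
  rewrite -subn1 -(ler_nat R) !natrD !natrM natrB ?radix_prod_gt0 //.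
  by rewrite -natr1; lra.
rewrite /max_digit_ratio topS.
apply: le_trans (div_sqrt_affine_le (N := n.+1%:R) _ _ _ _) => //; last first.
  by rewrite !ler_nat Ps_n ltnW.
have chord_gt0 : 0 < (top s)%:R + slope * (n.+1%:R - (P s)%:R).
  by rewrite ltr_pwDl // mulr_ge0 // subr_ge0 ler_nat.
rewrite ler_wpM2l // lef_pV2 ?posrE ?sqrtr_gt0 ?ler_sqrt //.
exact: lt_le_trans chord.
Qed.

Lemma counting_ratio_le (x : R) (s0 : nat) : (0 < s0)%N -> (top s0)%:R <= x ->
  exists2 s, (s0 <= s)%N &
    counting_ratio (digit_set r w) x <= max_digit_ratio R r w s.
Proof.
move=> s0_gt0 top_x; have g_mono := digit_enum_mono r_gt1 w_sup.
have x_ge0 : 0 <= x by apply: le_trans top_x.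
have [|n] := mono_leq_bracket (t := Num.truncn x) g_mono.
  by rewrite digit_enum0.
rewrite truncn_ge_nat // truncn_lt_nat // => gn_x_gnS.
have [gn_x x_gnS] := andP gn_x_gnS.
have [|s Ps_n] := mono_leq_bracket (t := n.+1) (radix_prod_mono r_gt1).
  by rewrite radix_prod0.
have s0_s : (s0 <= s)%N.
  have : (digit_enum r w (P s0).-1 < digit_enum r w n.+1)%N.
    by rewrite digit_enum_max // -(ltr_nat R) (le_lt_trans top_x).
  rewrite (leqW_mono g_mono) prednK ?radix_prod_gt0 // => Ps0_n.
  rewrite -ltnS -(leqW_mono (radix_prod_mono r_gt1)).
  by case/andP: Ps_n => _; apply: leq_ltn_trans.
have gn_gt0 : (0 < digit_enum r w n)%N.
  apply: leq_trans (mono_leq_infl g_mono n).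
  have := ltn_radix_prod r_gt1 s; case/andP: Ps_n; lia.
have ratio_le : counting_ratio (digit_set r w) x <=
    n.+1%:R / Num.sqrt (digit_enum r w n)%:R.
  rewrite /counting_ratio -range_digit_enum //.
  rewrite (counting_fun_range g_mono gn_x_gnS).
  rewrite ler_wpM2l // lef_pV2 ?posrE ?sqrtr_gt0 ?ltr0n ?ler_sqrt //.
  by apply: lt_le_trans gn_x; rewrite ltr0n.
have := le_trans ratio_le (digit_enum_ratio_le (leq_trans s0_gt0 s0_s) Ps_n).
by rewrite le_max => /orP[?|?]; [exists s | exists s.+1; rewrite // leqW].
Qed.

Lemma counting_ratio_max_digit_sum (s : nat) :
  counting_ratio (digit_set r w) ((top s)%:R : R) = max_digit_ratio R r w s.
Proof.
have g_mono := digit_enum_mono r_gt1 w_sup.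
congr (_%:R / _); rewrite -range_digit_enum // -digit_enum_max //.
rewrite (counting_fun_range (n := (P s).-1) g_mono) ?prednK ?radix_prod_gt0 //.
by rewrite lexx ltr_nat (leqW_mono g_mono) ltn_predL radix_prod_gt0.
Qed.

End CountingRatio.

Lemma limf_esup_le_dominated (T U : choiceType) (X : filteredType T)
    (Y : filteredType U) (R : realType) (f : X -> \bar R) (g : Y -> \bar R)
    (F : set (set X)) (G : set (set Y)) :
  (forall V, G V -> exists2 W, F W &
     forall x, W x -> exists2 y, V y & (f x <= g y)%E) ->
  (limf_esup f F <= limf_esup g G)%E.
Proof.
move=> fg; apply: le_ereal_inf_tmp => _ [V GV <-]; have [W FW WV] := fg V GV.
apply: le_trans (ereal_inf_lbound _) _; first by exists W.
apply: ge_ereal_sup => _ [x Wx <-]; have [y Vy fgxy] := WV x Wx.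
by apply: le_trans fgxy _; apply: ereal_sup_ubound; exists y.
Qed.

Lemma limf_esup_max (T : choiceType) (X : filteredType T) (R : realType)
    (f g : X -> \bar R) (F : set (set X)) : Filter F ->
  limf_esup (fun x => Order.max (f x) (g x)) F =
  Order.max (limf_esup f F) (limf_esup g F).
Proof.
move=> F_filter; apply/le_anti/andP; split; last first.
  by rewrite ge_max; apply/andP; split; apply: limf_esup_le_dominated => V FV;
    exists V => // x Vx; exists x; rewrite // le_max lexx ?orbT.
rewrite leNgt; apply/negP; rewrite gt_max => /andP[].
move=> /ereal_inf_lt[_ [V FV <-] supV] /ereal_inf_lt[_ [W FW <-] supW].
suff : (limf_esup (fun x => Order.max (f x) (g x)) F <=
    Order.max (ereal_sup (f @` V)) (ereal_sup (g @` W)))%E.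
  by rewrite leNgt gt_max supV supW.
apply: le_trans (ereal_inf_lbound _) _.
  by exists (V `&` W)%classic; first exact: filterI.
apply: ge_ereal_sup => _ [x [Vx Wx] <-]; rewrite ge_max !le_max.
by apply/andP; split; apply/orP; [left|right]; apply: ereal_sup_ubound;
  exists x.
Qed.

Lemma limf_esup_counting_ratio (R : realType) (r w : nat -> nat) :
  (forall i, (1 < r i)%N) -> superincreasing r w ->
  limf_esup (fun x : R => (counting_ratio (digit_set r w) x)%:E)
    (pinfty_nbhs R) =
  limn_esup (fun s => (max_digit_ratio R r w s)%:E).
Proof.
move=> r_gt1 w_sup; apply/le_anti/andP; split.
  apply: limf_esup_le_dominated => V [N _ NV].
  exists [set x | (max_digit_sum r w N.+1)%:R < x]%classic.
    by exists (max_digit_sum r w N.+1)%:R; split; rewrite ?num_real.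
  move=> x /ltW/(counting_ratio_le r_gt1 w_sup (ltn0Sn N))[s Ns ratio_le].
  by exists s; rewrite ?lee_fin //; apply/NV/ltnW.
apply: limf_esup_le_dominated => V [M [_ MV]].
exists [set s | (Num.truncn M < s)%N]%classic.
  by exists (Num.truncn M).+1.
move=> s /= M_s; exists (max_digit_sum r w s)%:R.
  apply: MV; apply: lt_le_trans (truncnS_gt M) _; rewrite ler_nat.
  exact: leq_trans M_s (leq_max_digit_sum r_gt1 w_sup s).
by rewrite counting_ratio_max_digit_sum.
Qed.

Lemma SX_max (R : realType) (A B : set nat) :
  SX R A B = Order.max
    (limf_esup (fun x : R => (counting_ratio A x)%:E) (pinfty_nbhs R))
    (limf_esup (fun x : R => (counting_ratio B x)%:E) (pinfty_nbhs R)).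
Proof.
rewrite -limf_esup_max; congr limf_esup; apply/funext => x.
by rewrite -EFin_max -maxr_pMl ?invr_ge0 ?sqrtr_ge0 // -natr_max.
Qed.

Lemma SX_digit_set (R : realType) (r w t v : nat -> nat) :
  (forall i, (1 < r i)%N) -> superincreasing r w ->
  (forall i, (1 < t i)%N) -> superincreasing t v ->
  SX R (digit_set r w) (digit_set t v) =
  limn_esup (fun s =>
    (Num.max (max_digit_ratio R r w s) (max_digit_ratio R t v s))%:E).
Proof.
move=> r_gt1 w_sup t_gt1 v_sup.
rewrite SX_max !limf_esup_counting_ratio // -limf_esup_max.
by congr limf_esup; apply/funext => s; rewrite EFin_max.
Qed.

Local Close Scope ring_scope.

Lemma mprodS (m : nat -> nat) (k : nat) : mprod m k.+1 = mprod m k * m k.+1.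
Proof. exact: big_nat_recr. Qed.

Lemma mprod_gt0 (m : nat -> nat) (k : nat) :
  (forall i, 0 < i -> 0 < m i) -> 0 < mprod m k.
Proof.
move=> m_gt0; elim: k => [|k IH]; first by rewrite /mprod big_geq.
by rewrite mprodS muln_gt0 IH m_gt0.
Qed.

Lemma leq_mprodSS (m : nat -> nat) (k : nat) :
  0 < m k.+2 -> m k.+1 * mprod m k <= mprod m k.+2.
Proof. by move=> m_gt0; rewrite !mprodS mulnC leq_pmulr. Qed.

Lemma digit_set_reindex (h h' r w : nat -> nat) : cancel h h' ->
  [set a | exists (eps : nat -> nat) (N : nat),
     [/\ forall i, eps (h i) < r i, forall i, N <= i -> eps (h i) = 0
       & a = \sum_(i < N) eps (h i) * w i] ]%classic = digit_set r w.
Proof.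
move=> hK; apply/seteqP; split=> _ [d [N [d_lt d_0 ->]]].
  by exists (d \o h), N.
exists (d \o h'), N; split=> [i|i /d_0|]; rewrite /digit_sum /= ?hK //.
by apply: eq_bigr => i _; rewrite hK.
Qed.

Lemma setA_digit_set (m : nat -> nat) :
  setA m = digit_set (fun i => m (2 * i + 1)) (fun i => mprod m (2 * i)).
Proof. by apply: (@digit_set_reindex (muln 2) half) => i; lia. Qed.

Lemma setB_digit_set (m : nat -> nat) :
  setB m = digit_set (fun i => m (2 * i + 2)) (fun i => mprod m (2 * i + 1)).
Proof. by apply: (@digit_set_reindex (fun i => 2 * i + 1) half) => i; lia. Qed.

Local Close Scope nat_scope.

Theorem theorem3 (R : realType) (m : nat -> nat)
    (hm : forall i : nat, (1 <= i)%N -> (2 <= m i)%N) :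
  SX R (setA m) (setB m) =
  limn_esup (fun s : nat =>
    (Num.max
      ((\prod_(i < s) m (2 * i + 1))%N%:R /
        Num.sqrt
          (\sum_(i < s) (m (2 * i + 1) - 1) * mprod m (2 * i))%N%:R)
      ((\prod_(i < s) m (2 * i + 2))%N%:R /
        Num.sqrt
          (\sum_(i < s) (m (2 * i + 2) - 1) * mprod m (2 * i + 1))%N%:R)
      : R)%R%:E).
Proof.
have m_gt0 i : (0 < i)%N -> (0 < m i)%N by move=> /hm/ltnW.
rewrite setA_digit_set setB_digit_set SX_digit_set //.
- by move=> i; apply: hm; rewrite addn1.
- split=> [|i]; first exact: mprod_gt0.
  by rewrite addn1 mulnS; apply/leq_mprodSS/m_gt0.
- by move=> i; apply: hm; rewrite addn2.
- split=> [|i]; first exact: mprod_gt0.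
  by rewrite addn2 !addn1 mulnS; apply/leq_mprodSS/m_gt0.
Qed.
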